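(* Let $V$ be a finite-dimensional irreducible $\boxtimes_q$-module of type $1$. Let $K:V\to V$ and $K^*:V\to V$ be the linear transformations given by the actions on $V$ of the generators $x_{02}$ and $x_{13}$ of $\boxtimes_q$, respectively. Then $K,K^*$ is a $q$-inverting pair on $V$.
   Context: $\mathbb F$ is an algebraically closed field and $q\in\mathbb F$ is nonzero and not a root of $1$. $\mathbb Z_4=\mathbb Z/4\mathbb Z$, and $[n]_q=(q^n-q^{-n})/(q-q^{-1})$ for $n=0,1,2,\dots$. The $q$-tetrahedron algebra $\boxtimes_q$ is the unital associative $\mathbb F$-algebra with generators $\{x_{rs}\mid r,s\in\mathbb Z_4,\ s-r=1\text{ or }s-r=2\}$ and relations: (i) for $r,s\in\mathbb Z_4$ with $s-r=2$, $x_{rs}x_{sr}=1$; (ii) for $r,s,t\in\mathbb Z_4$ such that $(s-r,t-s)$ is one of $(1,1),(1,2),(2,1)$, $\dfrac{q x_{rs}x_{st}-q^{-1}x_{st}x_{rs}}{q-q^{-1}}=1$; (iii) for $r,s,t,u\in\mathbb Z_4$ with $s-r=t-s=u-t=1$, $x_{rs}^3x_{tu}-[3]_q x_{rs}^2x_{tu}x_{rs}+[3]_q x_{rs}x_{tu}x_{rs}^2-x_{tu}x_{rs}^3=0$. Known fact used to define type: for every finite-dimensional irreducible $\boxtimes_q$-module $V$ there exist an integer $d\ge 0$ and $\varepsilon\in\{1,-1\}$ such that every generator $x_{rs}$ acts semisimply on $V$ with set of eigenvalues $\{\varepsilon q^{d-2i}\mid 0\le i\le d\}$. One calls $d$ the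 diameter and $\varepsilon$ the type of $V$. For a nonzero finite-dimensional $\mathbb F$-vector space $V$, a decomposition of $V$ is a sequence $\{V_i\}_{i=0}^d$ of nonzero subspaces with $V=\sum_{i=0}^d V_i$ (direct sum); set $V_{-1}=V_{d+1}=0$. A $q$-inverting pair on $V$ is an ordered pair of invertible linear transformations $K:V\to V$, $K^*:V\to V$ (here $K^*$ is just a name, not an adjoint of $K$) such that: (i) there is a decomposition $\{V_i\}_{i=0}^d$ of $V$ such that for $0\le i\le d$: $(K-q^{d-2i}I)V_i=0$, $K^*V_i\subseteq V_0+V_1+\cdots+V_{i+1}$, and $(K^* )^{-1}V_i\subseteq V_{i-1}+V_i+\cdots+V_d$; (ii) there is a decomposition $\{V_i^*\}_{i=0}^\delta$ of $V$ such that for $0\le i\le\delta$: $(K^*-q^{\delta-2i}I)V_i^*=0$, $KV_i^*\subseteq V_{i-1}^*+V_i^*+\cdots+V_\delta^*$, and $K^{-1}V_i^*\subseteq V_0^*+V_1^*+\cdots+V_{i+1}^*$ (with $V^*_{-1}=V^*_{\delta+1}=0$); (iii) there is no subspace $W\subseteq V$ with $KW\subseteq W$ and $K^*W\subseteq W$ other than $W=0$ and $W=V$. *)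

(* Defs.v *)
From HB Require Import structures.
From mathcomp Require Import all_boot all_algebra.
From mathcomp Require Import generic_quotient finmap boolp monalg.

Set Implicit Arguments.
Unset Strict Implicit.
Unset Printing Implicit Defensive.

Import GRing.Theory.
Local Open Scope quotient_scope.
Local Open Scope ring_scope.

Section QTetrahedronAlgebra.
Variables (F : fieldType) (q : F).

Definition qint (n : nat) : F := (q ^+ n - q ^- n) / (q - q^-1).

Definition tet_adm (r s : 'Z_4) : bool := (s - r == 1) || (s - r == 2).

Definition tet_index : Type := {rs : 'Z_4 * 'Z_4 | tet_adm rs.1 rs.2}.
HB.instance Definition _ := Choice.on tet_index.

(* The free algebra on the x_rs, as the algebra of the free monoid on them. *)
Definition tet_free : Type := {malg F[{fmonom tet_index}]}.
HB.instance Definition _ := GRing.Lalgebra.on tet_free.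

Definition free_x (r s : 'Z_4) (rs : tet_adm r s) : tet_free :=
  mkmalgU (fmu (exist _ (r, s) rs : tet_index)) 1.

Lemma free_scaleAr (c : F) (a b : tet_free) : c *: (a * b) = a * (c *: b).
Proof.
have ZE (d : {malg F[{fmonom tet_index}]}) : c *: d = d * malgC c.
  rewrite -mul_malgC !malgM_def fgmulUg fgmulgU.
  by apply: eq_bigr => k _; rewrite mul1m mulm1 mulrC.
rewrite (ZE (a * b)) (ZE b); exact/esym/mulrA.
Qed.

(* A defining relation  a = b  of the algebra is encoded by its relator a - b. *)
Inductive tet_relator : tet_free -> Prop :=
| Relator_inv (r s : 'Z_4) (rs : tet_adm r s) (sr : tet_adm s r) :
    s - r = 2 ->
    tet_relator (free_x rs * free_x sr - 1)
| Relator_qcomm (r s t : 'Z_4) (rs : tet_adm r s) (st : tet_adm s t) :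
    (s - r, t - s) \in [:: (1, 1); (1, 2); (2, 1)] ->
    tet_relator
      ((q - q^-1)^-1 *:
         (q *: (free_x rs * free_x st) - q^-1 *: (free_x st * free_x rs)) - 1)
| Relator_qSerre (r s t u : 'Z_4) (rs : tet_adm r s) (tu : tet_adm t u) :
    s - r = 1 -> t - s = 1 -> u - t = 1 ->
    let x := free_x rs in let y := free_x tu in
    tet_relator
      (x ^+ 3 * y - qint 3 *: (x ^+ 2 * y * x)
       + qint 3 *: (x * y * x ^+ 2) - y * x ^+ 3).

Inductive tet_ideal : tet_free -> Prop :=
| Ideal_relator a : tet_relator a -> tet_ideal a
| Ideal_zero : tet_ideal 0
| Ideal_add a b : tet_ideal a -> tet_ideal b -> tet_ideal (a + b)
| Ideal_mull c a : tet_ideal a -> tet_ideal (c * a)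
| Ideal_mulr c a : tet_ideal a -> tet_ideal (a * c).

Definition tet_ideal_pred : {pred tet_free} := fun a => `[< tet_ideal a >].

Fact tet_ideal_zmod_closed : zmod_closed tet_ideal_pred.
Proof.
split=> [|a b /asboolP Ia /asboolP Ib]; apply/asboolP; first exact: Ideal_zero.
by apply: Ideal_add => //; rewrite -mulN1r; apply: Ideal_mull.
Qed.
HB.instance Definition _ :=
  GRing.isZmodClosed.Build tet_free tet_ideal_pred tet_ideal_zmod_closed.

(* MathComp provides the additive group of this quotient; the multiplication *)
(* and the scaling of a quotient by a noncommutative ideal are added below. *)
Definition tetrahedron : Type := Quotient.quot tet_ideal_pred.
HB.instance Definition _ := GRing.Zmodule.on tetrahedron.

Definition tet_pi (a : tet_free) : tetrahedron :=
  \pi_(Quotient.quot tet_ideal_pred) a.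

Definition tet_repr (a : tetrahedron) : tet_free :=
  repr (a : Quotient.quot tet_ideal_pred).

Definition tet_one : tetrahedron := tet_pi 1.
Definition tet_mul (a b : tetrahedron) : tetrahedron :=
  tet_pi (tet_repr a * tet_repr b).
Definition tet_scale (c : F) (a : tetrahedron) : tetrahedron :=
  tet_pi (c *: tet_repr a).

Lemma tet_reprK a : tet_pi (tet_repr a) = a.
Proof. exact: reprK. Qed.

Lemma tet_piP a b : tet_pi a = tet_pi b <-> tet_ideal (a - b).
Proof.
split=> [/eqP|Iab]; last apply/eqP; rewrite -Quotient.idealrBE.
  by move/asboolP.
exact/asboolP.
Qed.

Lemma tet_piD a b : tet_pi (a + b) = tet_pi a + tet_pi b.
Proof. exact: (@Quotient.pi_add _ tet_ideal_pred). Qed.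

Lemma tet_ideal_repr a : tet_ideal (tet_repr (tet_pi a) - a).
Proof. by apply/tet_piP; rewrite tet_reprK. Qed.

Lemma tet_ideal_scale c a : tet_ideal a -> tet_ideal (c *: a).
Proof. by move=> Ia; rewrite -[a]mul1r scalerAl; apply: Ideal_mull. Qed.

Lemma tet_mul_pi a b : tet_mul (tet_pi a) (tet_pi b) = tet_pi (a * b).
Proof.
apply/tet_piP; set a' := tet_repr _; set b' := tet_repr _.
have -> : a' * b' - a * b = (a' - a) * b' + a * (b' - b).
  by rewrite mulrBl mulrBr addrA subrK.
by apply: Ideal_add; [apply: Ideal_mulr|apply: Ideal_mull];
   apply: tet_ideal_repr.
Qed.

Lemma tet_scale_pi c a : tet_scale c (tet_pi a) = tet_pi (c *: a).
Proof.
by apply/tet_piP; rewrite -scalerBr; apply/tet_ideal_scale/tet_ideal_repr.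
Qed.

Fact tet_mulA : associative tet_mul.
Proof.
move=> a b c; rewrite -[a]tet_reprK -[b]tet_reprK -[c]tet_reprK.
by rewrite !tet_mul_pi mulrA.
Qed.
Fact tet_mul1 : left_id tet_one tet_mul.
Proof. by move=> a; rewrite -[a]tet_reprK tet_mul_pi mul1r. Qed.
Fact tet_mulr1 : right_id tet_one tet_mul.
Proof. by move=> a; rewrite -[a]tet_reprK tet_mul_pi mulr1. Qed.
Fact tet_mulDl : left_distributive tet_mul +%R.
Proof.
move=> a b c; rewrite -[a]tet_reprK -[b]tet_reprK -[c]tet_reprK.
by rewrite -tet_piD !tet_mul_pi mulrDl tet_piD.
Qed.
Fact tet_mulDr : right_distributive tet_mul +%R.
Proof.
move=> a b c; rewrite -[a]tet_reprK -[b]tet_reprK -[c]tet_reprK.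
by rewrite -tet_piD !tet_mul_pi mulrDr tet_piD.
Qed.
HB.instance Definition _ := GRing.Zmodule_isPzRing.Build tetrahedron
  tet_mulA tet_mul1 tet_mulr1 tet_mulDl tet_mulDr.

Fact tet_scaleA c d a : tet_scale c (tet_scale d a) = tet_scale (c * d) a.
Proof. by rewrite -[a]tet_reprK !tet_scale_pi scalerA. Qed.
Fact tet_scale1 : left_id 1 tet_scale.
Proof. by move=> a; rewrite -[a]tet_reprK tet_scale_pi scale1r. Qed.
Fact tet_scaleDr : right_distributive tet_scale +%R.
Proof.
move=> c a b; rewrite -[a]tet_reprK -[b]tet_reprK.
by rewrite -tet_piD !tet_scale_pi scalerDr tet_piD.
Qed.
Fact tet_scaleDl a : {morph tet_scale^~ a : c d / c + d}.
Proof.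
by move=> c d; rewrite -[a]tet_reprK !tet_scale_pi scalerDl tet_piD.
Qed.
HB.instance Definition _ := GRing.Zmodule_isLmodule.Build F tetrahedron
  tet_scaleA tet_scale1 tet_scaleDr tet_scaleDl.

(* The lalgType structures of MathComp require 1 != 0, which fails when *)
(* q - q^-1 = 0; so that q needs no proof argument here, *)
(* the algebra is a pzRingType and an lmodType satisfying the next two laws. *)
Lemma tet_scaleAl (c : F) (a b : tetrahedron) : c *: (a * b) = c *: a * b.
Proof.
rewrite -[a]tet_reprK -[b]tet_reprK.
rewrite /GRing.scale /GRing.mul /= tet_scale_pi !tet_mul_pi tet_scale_pi.
by congr tet_pi; apply: scalerAl.
Qed.

Lemma tet_scaleAr (c : F) (a b : tetrahedron) : c *: (a * b) = a * (c *: b).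
Proof.
rewrite -[a]tet_reprK -[b]tet_reprK.
rewrite /GRing.scale /GRing.mul /= tet_scale_pi !tet_mul_pi tet_scale_pi.
by congr tet_pi; apply: free_scaleAr.
Qed.

Lemma tet_piM a b : tet_pi (a * b) = tet_pi a * tet_pi b.
Proof. by rewrite -tet_mul_pi. Qed.
Lemma tet_piZ c a : tet_pi (c *: a) = c *: tet_pi a.
Proof. by rewrite -tet_scale_pi. Qed.
Lemma tet_piB a b : tet_pi (a - b) = tet_pi a - tet_pi b.
Proof. by apply/eqP; rewrite eq_sym subr_eq -tet_piD subrK. Qed.

Lemma tet_piX a n : tet_pi (a ^+ n) = tet_pi a ^+ n.
Proof. by elim: n => // n IHn; rewrite !exprS tet_piM IHn. Qed.
Lemma tet_pi0 : tet_pi 0 = 0.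
Proof. by apply: (addrI (tet_pi 0)); rewrite -tet_piD !addr0. Qed.
Lemma tet_ideal_pi0 a : tet_ideal a -> tet_pi a = 0.
Proof. by move=> Ia; rewrite -tet_pi0; apply/tet_piP; rewrite subr0. Qed.

Definition tet_x (r s : 'Z_4) (rs : tet_adm r s) : tetrahedron :=
  tet_pi (free_x rs).

Lemma tet_x_inv r s (rs : tet_adm r s) (sr : tet_adm s r) :
  s - r = 2 -> tet_x rs * tet_x sr = 1.
Proof.
move=> rs2; rewrite -tet_piM; apply/tet_piP.
exact/Ideal_relator/Relator_inv.
Qed.

Lemma tet_x_qcomm r s t (rs : tet_adm r s) (st : tet_adm s t) :
    (s - r, t - s) \in [:: (1, 1); (1, 2); (2, 1)] ->
  (q - q^-1)^-1 *:
    (q *: (tet_x rs * tet_x st) - q^-1 *: (tet_x st * tet_x rs)) = 1.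
Proof.
move=> rst; rewrite -!tet_piM -!tet_piZ -tet_piB -tet_piZ; apply/tet_piP.
exact/Ideal_relator/Relator_qcomm.
Qed.

Lemma tet_x_qSerre r s t u (rs : tet_adm r s) (tu : tet_adm t u) :
    s - r = 1 -> t - s = 1 -> u - t = 1 ->
  tet_x rs ^+ 3 * tet_x tu - qint 3 *: (tet_x rs ^+ 2 * tet_x tu * tet_x rs)
  + qint 3 *: (tet_x rs * tet_x tu * tet_x rs ^+ 2) - tet_x tu * tet_x rs ^+ 3
  = 0.
Proof.
have piE (a b c d : tet_free) k A B C D : tet_pi a = A -> tet_pi b = B ->
    tet_pi c = C -> tet_pi d = D ->
    tet_pi (a - k *: b + k *: c - d) = A - k *: B + k *: C - D.
  move=> <- <- <- <-; rewrite -(tet_piZ k b) -(tet_piZ k c).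
  by move: (k *: b) (k *: c) => b' c'; rewrite tet_piB tet_piD tet_piB.
move=> sr ts ut; move: (Ideal_relator (Relator_qSerre rs tu sr ts ut)) => /=.
rewrite /tet_x; move: (free_x rs) (free_x tu) (qint 3) => x y k /tet_ideal_pi0.
move=> pi0; rewrite -[RHS]pi0; apply/esym/piE.
- by rewrite tet_piM (tet_piX x).
- by rewrite tet_piM (tet_piM (x ^+ 2)) (tet_piX x).
- by rewrite tet_piM -(tet_piM x y) -(tet_piX x 2).
- by rewrite tet_piM (tet_piX x).
Qed.

Lemma tet_gen_ind (P : tetrahedron -> Prop) :
    P 1 -> (forall a b, P a -> P b -> P (a + b)) ->
    (forall a b, P a -> P b -> P (a * b)) ->
    (forall (c : F) a, P a -> P (c *: a)) ->
    (forall r s (rs : tet_adm r s), P (tet_x rs)) ->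
  forall a, P a.
Proof.
move=> P1 PD PM PZ Px a; rewrite -[a]tet_reprK; move: (tet_repr a) => {}a.
have P0 : P 0 by have := PZ 0 _ P1; rewrite scale0r.
have -> : a = \sum_(k <- msupp a) a@_k *: (mkmalgU k 1 : tet_free).
  rewrite {1}[a]monalgE; apply: eq_bigr => k _.
  by apply/malgP => m; rewrite mcoeffZ !mcoeffU mulrnAr mulr1.
elim/big_rec: _ => [|k b _ Pb]; first by rewrite tet_pi0.
rewrite tet_piD tet_piZ; apply: PD => //; apply: PZ.
case: k => k; rewrite -fmE; elim: k => [|[[r s] rs] k IHk].
  exact: P1.
have -> : mkmalgU (fmonom_of_seq fmonom_key (exist _ (r, s) rs :: k)) 1
    = (free_x rs : {malg F[{fmonom tet_index}]})
        * mkmalgU (fmonom_of_seq fmonom_key k) 1.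
  rewrite malgM_def fgmulUU mulr1; congr mkmalgU.
  by rewrite /mmul /= /fmmul /fmu !fmE.
rewrite tet_piM; apply: PM IHk; exact: (Px _ _ rs).
Qed.

End QTetrahedronAlgebra.

(* Keeps failed unification problems from computing in the free algebra. *)
#[global] Opaque tet_x tet_mul tet_scale tet_pi tet_repr.

Record tet_module (F : fieldType) (q : F) (V : vectType F) := TetModule {
  tet_act :> tetrahedron q -> 'End(V);
  tet_act_linear : linear tet_act;
  tet_act1 : tet_act 1 = \1%VF;
  tet_actM : forall a b, tet_act (a * b) = (tet_act a \o tet_act b)%VF
}.

Section QTetrahedronModules.
Variables (F : fieldType) (q : F) (V : vectType F).

Definition tet_irreducible (M : tet_module q V) : Prop :=
  fullv != 0%VS :> {vspace V} /\
  forall W : {vspace V}, (forall a, M a @: W <= W)%VS -> W = 0%VS \/ W = fullv.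

(* Semisimple over an algebraically closed field: V is spanned by eigenvectors. *)
Definition semisimple (f : 'End(V)) : Prop :=
  exists s : seq F, (\sum_(a <- s) passmx.leigenspace f a)%VS = fullv.

Definition has_diameter_type (M : tet_module q V) (d : nat) (eps : F) : Prop :=
  forall (r s : 'Z_4) (rs : tet_adm r s),
    semisimple (M (tet_x q rs)) /\
    forall a : F, passmx.leigenvalue (M (tet_x q rs)) a <->
      exists2 i : nat, (i <= d)%N & a = eps * q ^ (d%:Z - (2 * i)%N%:Z).

Definition has_type (M : tet_module q V) (eps : F) : Prop :=
  (eps = 1 \/ eps = -1) /\ exists d : nat, has_diameter_type M d eps.

Definition decomposition (d : nat) (U : 'I_d.+1 -> {vspace V}) : Prop :=
  [/\ forall i, U i != 0%VS,
      (\sum_i U i)%VS = fullv &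
      directv (\sum_i U i)%VS].

(* As the sums only range over indices in 0..d, the convention *)
(* U_(-1) = U_(d+1) = 0 is built in; i <= j.+1 stands for i - 1 <= j. *)
Definition q_inverting_pair (K K' : 'End(V)) : Prop :=
  [/\ bijective K /\ bijective K',
      exists (d : nat) (U : 'I_d.+1 -> {vspace V}),
        decomposition U /\
        forall i : 'I_d.+1,
          [/\ ((K - q ^ (d%:Z - (2 * i)%N%:Z) *: \1) @: U i)%VS = 0%VS,
              (K' @: U i <= \sum_(j < d.+1 | (j <= i.+1)%N) U j)%VS &
              (K'^-1 @: U i <= \sum_(j < d.+1 | (i <= j.+1)%N) U j)%VS],
      exists (d : nat) (U : 'I_d.+1 -> {vspace V}),
        decomposition U /\
        forall i : 'I_d.+1,
          [/\ ((K' - q ^ (d%:Z - (2 * i)%N%:Z) *: \1) @: U i)%VS = 0%VS,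
              (K @: U i <= \sum_(j < d.+1 | (i <= j.+1)%N) U j)%VS &
              (K^-1 @: U i <= \sum_(j < d.+1 | (j <= i.+1)%N) U j)%VS] &
      forall W : {vspace V},
        (K @: W <= W)%VS -> (K' @: W <= W)%VS -> W = 0%VS \/ W = fullv].

End QTetrahedronModules.

Definition x02 (F : fieldType) (q : F) : tetrahedron q :=
  @tet_x F q 0 2 isT.
Definition x13 (F : fieldType) (q : F) : tetrahedron q :=
  @tet_x F q 1 3 isT.

(* Main.v *)
Require Import Defs.
From mathcomp Require Import all_boot all_algebra.
From mathcomp Require Import zify ring.

(** Everything rests on four flags of V, one for each vertex r of the square
    Z/4Z, and on counting dimensions along them.

    Call (f, g) a q-Weyl pair when q f g - q^-1 g f = (q - q^-1) I. If
    g v = a v, then f v - a^-1 v is an eigenvector of g for q^2 a, or zero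
    ([qWeyl_shift]). So f is triangular, with known diagonal, on the
    eigenspaces of g, and conversely; hence the first j eigenspaces of g,
    counted from q^d downwards, have the same sum as the first j eigenspaces
    of f, counted from q^-d upwards ([eq_flag]). By the q-commutation relations
    and x_(r,r+2) x_(r+2,r) = 1, the sum of the first j eigenspaces of x_(r,s)
    from q^d downwards depends only on r and j, and from q^-d upwards only on
    s and j, through the same function [vflag].

    Triangular action: (x_(r,r+1), x_(r+1,r+3)) is a q-Weyl pair, so that
    x_(r+1,r+3) maps step j of the flag at r into step j + 1 ([x2_raises]).
    The partial sums of the eigenspaces of x_02 form the flags at 0 and 2,
    which x_13 and x_31 = x_13^-1 respectively raise; the partial sums for x_13
    form the flags at 1 and 3, which x_20 = x_02^-1 and x_02 respectively
    raise. These are the four inclusions in the definition of a q-inverting pair.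

    Irreducibility: let W be stable under x_02 and x_13, let a_r(j) be the
    dimension of the intersection of W with step j of the flag at r, and let
    j + k = d + 1. As x_(r,r+2) is diagonalizable on W,
    dim W <= a_r(j) + a_(r+2)(k). As the eigenspaces of x_(r,r+1) are
    independent, a_r(j) + a_(r+1)(k) <= dim W. Going around the square, the
    inequality for the edge (r+2,r+3) and the two diagonals force equality for
    the edge (r,r+1). So W is the sum of its intersections with two
    complementary sums of eigenspaces of x_(r,r+1), wherever the spectrum is
    cut; therefore x_(r,r+1) preserves W ([split_stable]), and W is a
    submodule. *)

Set Implicit Arguments.
Unset Strict Implicit.
Unset Printing Implicit Defensive.
Import GRing.Theory passmx.
Local Open Scope ring_scope.

(** * Sums of eigenspaces *)
Section EigenspaceSums.
Variables (F : fieldType) (V : vectType F).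
Implicit Types (f g : 'End(V)) (W U : {vspace V}) (a c : F) (s t : seq F).

(** The eigenspaces are cut down to a subspace W so that the same lemmas
    describe the eigenvectors of f inside a stable subspace. *)
Definition eigsum W f s : {vspace V} :=
  (\sum_(a <- s) (W :&: leigenspace f a))%VS.

Lemma mem_leigenspace f a v : (v \in leigenspace f a) = (f v == a *: v).
Proof.
by rewrite memv_ker add_lfunE opp_lfunE scale_lfunE id_lfunE subr_eq0.
Qed.

Lemma eigsum_cons W f c s :
  eigsum W f (c :: s) = (W :&: leigenspace f c + eigsum W f s)%VS.
Proof. exact: big_cons. Qed.

Lemma eigsum_cat W f s t :
  eigsum W f (s ++ t) = (eigsum W f s + eigsum W f t)%VS.
Proof. exact: big_cat. Qed.

Lemma eigsum_rev W f s : eigsum W f (rev s) = eigsum W f s.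
Proof. exact/perm_big/permPl/perm_rev. Qed.

Lemma sub_eigsumP W f s U :
  (forall a, a \in s -> (W :&: leigenspace f a <= U)%VS) ->
  (eigsum W f s <= U)%VS.
Proof.
elim: s => [|c s IHs] sU; first by rewrite /eigsum big_nil sub0v.
rewrite eigsum_cons subv_add sU ?mem_head //=.
by apply: IHs => a sa; apply: sU; rewrite inE sa orbT.
Qed.

Lemma leigenspace_sub_eigsum W f s a :
  a \in s -> (W :&: leigenspace f a <= eigsum W f s)%VS.
Proof.
elim: s => // c s IHs; rewrite inE eigsum_cons => /predU1P[->|/IHs sa].
  exact: addvSl.
exact: subv_trans sa (addvSr _ _).
Qed.

Lemma eigsum_sub W f s : (eigsum W f s <= W)%VS.
Proof. by apply: sub_eigsumP => a _; apply: capvSl. Qed.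

Lemma limg_eigsum_sub W f s : (f @: eigsum W f s <= eigsum W f s)%VS.
Proof.
rewrite /eigsum limg_sum -/(eigsum _ _ _); elim: s => [|c s IHs].
  by rewrite big_nil sub0v.
rewrite big_cons eigsum_cons addvS //; apply/subvP => _ /memv_imgP[v vE ->].
move: vE; rewrite memv_cap mem_leigenspace => /andP[vW /eqP fv].
by rewrite memv_cap mem_leigenspace fv linearZ /= fv memvZ //= eqxx.
Qed.

(** On a sum of eigenspaces for values other than c, the map f - c is
    surjective: it scales each of these eigenspaces by a nonzero factor. *)
Lemma eigsum_sub_limg W f s c : c \notin s ->
  (eigsum W f s <= (f - c *: \1) @: eigsum W f s)%VS.
Proof.
rewrite {2}/eigsum limg_sum; elim: s => [|a s IHs].
  by rewrite /eigsum !big_nil.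
rewrite inE negb_or eigsum_cons big_cons => /andP[ca /IHs {}IHs].
rewrite addvS //; apply/subvP => v; rewrite memv_cap => /andP[vW vE].
have -> : v = (f - c *: \1)%VF ((a - c)^-1 *: v).
  move: vE; rewrite mem_leigenspace => /eqP fv.
  rewrite linearZ /= add_lfunE opp_lfunE scale_lfunE id_lfunE fv -scalerBl.
  by rewrite scalerA mulVf ?scale1r // subr_eq0 eq_sym.
by rewrite memv_img // memvZ // memv_cap vW.
Qed.

(** By surjectivity f v - c v = f u - c u for some u in the sum, and then
    v - u is an eigenvector for c. This one step gives the stable splitting of
    invariant subspaces below and the comparison of flags. *)
Lemma eigsum_lift W f s c v : c \notin s -> v \in W ->
  f v - c *: v \in eigsum W f s -> v \in eigsum W f (c :: s).
Proof.
move=> cs vW /(subvP (eigsum_sub_limg W f cs)) /memv_imgP[u us].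
rewrite add_lfunE opp_lfunE scale_lfunE id_lfunE => fvu.
rewrite eigsum_cons -[v](subrK u) memv_add // memv_cap mem_leigenspace.
rewrite memvB // ?(subvP (eigsum_sub _ _ _) u us) //= linearB /=.
rewrite scalerBr -{1}(subrK (c *: v) (f v)) fvu addrAC [f u - _ - _]addrAC.
by rewrite subrr add0r addrC.
Qed.

(** For w in W with eigencomponents in c :: s, the vector f w - c w is again in
    W and has no c-component, so induction on s applies to it and [eigsum_lift]
    brings the conclusion back to w. *)
Lemma cap_eigsum_sub W f s : (f @: W <= W)%VS -> uniq s ->
  (W :&: eigsum fullv f s <= eigsum W f s)%VS.
Proof.
move=> fW; elim: s => [|c s IHs].
  by rewrite /eigsum !big_nil capv0.
case/andP=> cs /IHs {}IHs; apply/subvP => w; rewrite memv_cap => /andP[wW].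
rewrite eigsum_cons capfv => /memv_addP[a aE [b bs wE]].
apply: eigsum_lift => //; apply: (subvP IHs); rewrite memv_cap; apply/andP.
have fwW : f w \in W by apply: (subvP fW); apply: memv_img.
split; first by rewrite memvB // memvZ.
move: aE; rewrite mem_leigenspace => /eqP fa.
rewrite wE linearD /= fa scalerDr opprD addrACA subrr add0r memvB //.
  exact: (subvP (limg_eigsum_sub _ _ _)) (memv_img f bs).
exact: memvZ.
Qed.

(** As f - c maps the sum onto itself, it is injective there for dimension
    reasons. *)
Lemma eigsum_cap_leigenspace f s c :
  c \notin s -> (eigsum fullv f s :&: leigenspace f c = 0)%VS.
Proof.
move=> cs; apply/eqP; rewrite -dimv_eq0.
have := dimvS (eigsum_sub_limg fullv f cs).
have := limg_ker_dim (f - c *: \1)%VF (eigsum fullv f s).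
by rewrite -/(leigenspace f c); lia.
Qed.

Lemma eigsum_cap_eigsum f s t :
  uniq (s ++ t) -> (eigsum fullv f s :&: eigsum fullv f t = 0)%VS.
Proof.
rewrite cat_uniq => /and3P[_ /hasPn st ut]; apply/eqP; rewrite -subv0.
apply: subv_trans (cap_eigsum_sub (limg_eigsum_sub _ _ _) ut) _.
by apply: sub_eigsumP => c /st cs; rewrite eigsum_cap_leigenspace.
Qed.

Lemma dim_stable_split W f s t : (f @: W <= W)%VS -> uniq (s ++ t) ->
    eigsum fullv f (s ++ t) = fullv ->
  (\dim W <= \dim (W :&: eigsum fullv f s) + \dim (W :&: eigsum fullv f t))%N.
Proof.
move=> fW ust full; have := cap_eigsum_sub fW ust.
rewrite full capvf eigsum_cat => /dimvS/leq_trans; apply.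
apply: leq_trans (dimv_add_leqif _ _) _.
have sW r : (eigsum W f r <= W :&: eigsum fullv f r)%VS.
  rewrite subv_cap eigsum_sub; apply: sub_eigsumP => a ra.
  by rewrite (subv_trans _ (leigenspace_sub_eigsum fullv f ra)) ?capvS ?subvf.
by rewrite leq_add ?dimvS.
Qed.

(** Stability detected by dimensions alone. At each cut of the spectrum the
    bound makes W the direct sum of its two pieces; comparing the cuts on both
    sides of an eigenvalue c then isolates the c-component of a vector of W. *)
Lemma split_stable W f s : uniq s -> eigsum fullv f s = fullv ->
    (forall s1 s2, s = s1 ++ s2 ->
      (\dim W <= \dim (W :&: eigsum fullv f s1)
                 + \dim (W :&: eigsum fullv f s2))%N) ->
  (f @: W <= W)%VS.
Proof.
move=> us full splitW.
suff sub s1 s2 : s = s1 ++ s2 -> (W :&: eigsum fullv f s1 <= eigsum W f s1)%VS.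
  have Ws : (W <= eigsum W f s)%VS.
    by have := sub s [::]; rewrite cats0 full capvf; apply.
  apply: subv_trans (limgS f Ws) _.
  exact: subv_trans (limg_eigsum_sub _ _ _) (eigsum_sub _ _ _).
elim/last_ind: s1 s2 => [|s1 c IHs] s2.
  by rewrite /eigsum !big_nil capv0.
(* The cut just before c; w = a + b along it. *)
rewrite -cats1 -catA cat1s => sE; have {}IHs := IHs _ sE.
have dj : (eigsum fullv f s1 :&: eigsum fullv f (c :: s2) = 0)%VS.
  by rewrite eigsum_cap_eigsum // -sE.
have /subvP Wsplit : (W <= W :&: eigsum fullv f s1
                          + W :&: eigsum fullv f (c :: s2))%VS.
  have le : (W :&: eigsum fullv f s1 + W :&: eigsum fullv f (c :: s2) <= W)%VS.
    by rewrite subv_add !capvSl.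
  rewrite -(geq_leqif (dimv_leqif_sup le)) dimv_disjoint_sum ?splitW //.
  by apply/eqP; rewrite -subv0 -dj capvS ?capvSr.
apply/subvP=> w; rewrite memv_cap => /andP[wW ws].
have /memv_addP[a aW [b]] := Wsplit _ wW.
rewrite memv_cap => /andP[bW bs wE].
rewrite cats1 /eigsum -cats1 -/(eigsum _ _ _) eigsum_cat wE.
rewrite memv_add ?(subvP IHs) //.
rewrite eigsum_cons /eigsum big_nil addv0 memv_cap bW /=.
(* By the modular law, b lies in the eigenspace for c. *)
have {1}-> : leigenspace f c = (leigenspace f c
   + eigsum fullv f s1 :&: eigsum fullv f (c :: s2))%VS by rewrite dj addv0.
rewrite vspace_modl; last by rewrite eigsum_cons capfv addvSl.
rewrite memv_cap bs andbT -(addKr a b) -wE addvC memvD //; last first.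
  by move: ws; rewrite eigsum_cat eigsum_cons /eigsum big_nil addv0 capfv.
rewrite memvN (subvP (addvSl _ _)) //.
by move: aW; rewrite memv_cap => /andP[].
Qed.

End EigenspaceSums.

(** * Flags of a transformation with eigenvalues q^d, q^(d-2), ..., q^-d *)
Section QFlags.
Variables (F : fieldType) (V : vectType F).
Implicit Types (q : F) (d i j k : nat) (f g : 'End(V)).

Definition generic q : Prop := q != 0 /\ forall n, (0 < n)%N -> q ^+ n != 1.

Definition qpow q d i : F := q ^ (d%:Z - (2 * i)%N%:Z).

Definition eigseq q d j : seq F := [seq qpow q d i | i <- iota 0 j].

(** The first j eigenspaces from q^d downwards. The flag from q^-d upwards is
    the same expression with q^-1 for q, so one proof serves both ends of
    the spectrum. *)
Definition flag q d f j : {vspace V} := eigsum fullv f (eigseq q d j).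

Definition q_diagonalizable q d f : Prop := flag q d f d.+1 = fullv.

Definition qWeyl q f g : Prop :=
  forall v, q *: f (g v) - q^-1 *: g (f v) = (q - q^-1) *: v.

Lemma qWeylV q f g : qWeyl q f g -> qWeyl q^-1 g f.
Proof.
by move=> fg v; rewrite invrK -opprB fg -scaleNr opprB.
Qed.

Lemma genericV q : generic q -> generic q^-1.
Proof.
by case=> q0 q1; split=> [|n n0]; rewrite ?invr_eq0 // exprVn invr_eq1 q1.
Qed.

Lemma generic_exprz_inj q : generic q -> injective (fun m : int => q ^ m).
Proof.
case=> q0 q1 m n qmn.
have : q ^ (m - n) = 1 by rewrite expfzDr // qmn -expfzDr // subrr.
have [k [] mnE] : exists k : nat, m - n = k%:Z \/ m - n = - k%:Z.
- by exists `|m - n|%N; lia.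
- rewrite mnE -exprnP => /eqP; case: k mnE => [|k] mnE; first by lia.
  by rewrite (negPf (q1 _ _)).
rewrite mnE -invr_expz -exprnP => /eqP; rewrite invr_eq1.
case: k mnE => [|k] mnE; first by lia.
by rewrite (negPf (q1 _ _)).
Qed.

Lemma qpow_inj q d : generic q -> injective (qpow q d).
Proof. by move=> qg i j /(generic_exprz_inj qg); lia. Qed.

Lemma mem_eigseq q d i j : generic q ->
  (qpow q d i \in eigseq q d j) = (i < j)%N.
Proof.
by move=> qg; rewrite (mem_map (qpow_inj qg)) mem_iota.
Qed.

Lemma eigseq_uniq q d j : generic q -> uniq (eigseq q d j).
Proof. by move=> qg; rewrite map_inj_uniq ?iota_uniq //; apply: qpow_inj. Qed.

Lemma size_eigseq q d j : size (eigseq q d j) = j.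
Proof. by rewrite size_map size_iota. Qed.

(** Since q^(2i - d) = q^(d - 2(d - i)), the k values from the bottom, read
    backwards, complete the j values from the top. *)
Lemma eigseq_cat q d j k : (j + k = d.+1)%N ->
  eigseq q d d.+1 = eigseq q d j ++ rev (eigseq q^-1 d k).
Proof.
move=> jk; apply: (@eq_from_nth _ 0).
  by rewrite size_cat size_rev !size_eigseq.
rewrite size_eigseq => i id; rewrite nth_cat size_eigseq.
rewrite (nth_map 0%N) ?size_iota // nth_iota // add0n.
case: ltnP => ij; first by rewrite (nth_map 0%N) ?size_iota // nth_iota.
rewrite nth_rev size_eigseq; last lia.
rewrite (nth_map 0%N) ?size_iota ?nth_iota; try lia.
rewrite /qpow exprz_inv; congr (_ ^ _); lia.
Qed.

Lemma q_diagonalizableV q d f :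
  q_diagonalizable q d f -> q_diagonalizable q^-1 d f.
Proof.
rewrite /q_diagonalizable => df.
rewrite -[RHS]df /flag (@eigseq_cat q d 0 d.+1) //.
by rewrite eigsum_rev.
Qed.

Lemma flagS q d f j :
  flag q d f j.+1 = (leigenspace f (qpow q d j) + flag q d f j)%VS.
Proof.
rewrite /flag /eigseq -{1}addn1 iotaD map_cat eigsum_cat addvC.
congr (_ + _)%VS.
by rewrite /= eigsum_cons /eigsum big_nil addv0 capfv.
Qed.

Lemma leigenspace_notin q d f a : q_diagonalizable q d f ->
  a \notin eigseq q d d.+1 -> leigenspace f a = 0%VS.
Proof.
by move=> df /(eigsum_cap_leigenspace f); rewrite -/(flag _ _ _ _) df capfv.
Qed.

Lemma leigenspace_qpow_gt q d f i : generic q -> q_diagonalizable q d f ->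
  (d < i)%N -> leigenspace f (qpow q d i) = 0%VS.
Proof.
by move=> qg df di; rewrite (leigenspace_notin df) // mem_eigseq // -leqNgt.
Qed.

(** Evaluating the relation at v gives q^-1 g (f v) = q a f v - (q - q^-1) v;
    subtracting a^-1 v from f v removes the inhomogeneous term. *)
Lemma qWeyl_shift q f g a v : generic q -> qWeyl q f g -> a != 0 ->
  v \in leigenspace g a -> f v - a^-1 *: v \in leigenspace g (q ^+ 2 * a).
Proof.
case=> q0 _ fg a0; rewrite !mem_leigenspace => /eqP gv; apply/eqP.
have gfv : g (f v) = q *: (q *: (a *: f v) - (q - q^-1) *: v).
  rewrite -(fg v) gv [f (_ *: _)]linearZ /= opprB subrKC.
  by rewrite scalerA mulfV // scale1r.
rewrite [LHS]linearB [X in _ - X = _]linearZ /= gv gfv !scalerBr !scalerA.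
rewrite -addrA -opprD -scalerDl; congr (_ *: _ - _ *: _); field.
by rewrite q0 a0.
Qed.

(** Multiplying the eigenvalue by q^2 moves one place towards q^d, and the
    eigenspace beyond q^d is zero. *)
Lemma qWeyl_shift_qpow q d f g i v : generic q -> qWeyl q f g ->
    q_diagonalizable q d g -> v \in leigenspace g (qpow q d i) ->
  f v - qpow q^-1 d i *: v \in flag q d g i.
Proof.
move=> qg fg dg.
have q0 := proj1 qg.
have /(qWeyl_shift qg fg)/[apply] : qpow q d i != 0 by rewrite expfz_neq0.
rewrite /qpow invr_expz -exprz_inv => sh.
case: i sh => [|i]; last first.
  move=> sh; rewrite flagS; apply: (subvP (addvSl _ _)).
  suff -> : qpow q d i = q ^+ 2 * q ^ (d%:Z - (2 * i.+1)%N%:Z) by [].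
  rewrite /qpow exprnP -expfzDr //; congr (_ ^ _); lia.
rewrite exprnP -expfzDr // (leigenspace_notin dg) ?memv0 => [/eqP->|].
  exact: mem0v.
apply/mapP => -[k _] /(generic_exprz_inj qg); lia.
Qed.

(** Induction on j: for v in the next eigenspace of g, f v - c v lies in the
    part of the flag already compared, so [eigsum_lift] applies to f. *)
Lemma sub_flag q d f g j : generic q -> qWeyl q f g ->
  q_diagonalizable q d g -> (flag q d g j <= flag q^-1 d f j)%VS.
Proof.
move=> qg fg dg; elim: j => [|j IHj]; first by rewrite /flag /eigsum !big_nil.
rewrite flagS subv_add; apply/andP; split; last first.
  by apply: subv_trans IHj _; rewrite flagS addvSr.
apply/subvP => v /(qWeyl_shift_qpow qg fg dg)/(subvP IHj).
have cj : qpow q^-1 d j \notin eigseq q^-1 d j.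
  by rewrite mem_eigseq ?ltnn //; apply: genericV.
move/(eigsum_lift cj (memvf v)).
by rewrite eigsum_cons capfv flagS.
Qed.

(** The relation is symmetric under q <-> q^-1 and f <-> g, which turns
    [sub_flag] into the reverse inclusion. *)
Lemma eq_flag q d f g j : generic q -> qWeyl q f g ->
  q_diagonalizable q d f -> q_diagonalizable q d g ->
  flag q d g j = flag q^-1 d f j.
Proof.
move=> qg fg df dg; apply/eqP; rewrite eqEsubv sub_flag //=.
rewrite -{2}[q]invrK; apply: sub_flag; first exact: genericV.
  exact: qWeylV.
exact: q_diagonalizableV.
Qed.

(** Counted from q^-d, multiplication of the eigenvalue by q^2 is a move to
    the next eigenspace. *)
Lemma limg_flag_sub q d f g j : generic q -> qWeyl q f g ->
  (f @: flag q^-1 d g j <= flag q^-1 d g j.+1)%VS.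
Proof.
move=> qg fg; elim: j => [|j IHj].
  by rewrite /flag /eigsum big_nil limg0 sub0v.
rewrite flagS limgD subv_add; apply/andP; split; last first.
  by apply: subv_trans IHj _; rewrite [X in (_ <= X)%VS]flagS addvSr.
have [q0 _] := qg; pose c := qpow q^-1 d j.
have c0 : c != 0 by rewrite expfz_neq0 ?invr_eq0.
apply/subvP => _ /memv_imgP[v vE ->].
rewrite -[f v](subrK (c^-1 *: v)) 2!flagS addvA (subvP (addvSl _ _)) //.
apply: memv_add; last exact: memvZ.
have -> : qpow q^-1 d j.+1 = q ^+ 2 * c; last exact: (qWeyl_shift qg fg).
by rewrite /c /qpow !exprz_inv exprnP -expfzDr //; congr (_ ^ _); lia.
Qed.

Lemma flag_cap0 q d f j k : generic q -> (j + k = d.+1)%N ->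
  (flag q d f j :&: flag q^-1 d f k = 0)%VS.
Proof.
move=> qg jk; rewrite /flag -(eigsum_rev _ _ (eigseq q^-1 _ _)).
by rewrite eigsum_cap_eigsum // -eigseq_cat // eigseq_uniq.
Qed.

Lemma dim_stable_flags q d f W j k : generic q -> q_diagonalizable q d f ->
    (f @: W <= W)%VS -> (j + k = d.+1)%N ->
  (\dim W <= \dim (W :&: flag q d f j) + \dim (W :&: flag q^-1 d f k))%N.
Proof.
move=> qg df fW jk; rewrite /flag -(eigsum_rev _ _ (eigseq q^-1 _ _)).
by apply: dim_stable_split; rewrite -?eigseq_cat ?eigseq_uniq.
Qed.

Lemma flags_stable q d f W : generic q -> q_diagonalizable q d f ->
    (forall j k, (j + k = d.+1)%N ->
      \dim W <= \dim (W :&: flag q d f j) + \dim (W :&: flag q^-1 d f k))%N ->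
  (f @: W <= W)%VS.
Proof.
move=> qg df splitW; apply: (split_stable (eigseq_uniq _ _ qg) df) => s1 s2 sE.
have jk : (size s1 + size s2)%N = d.+1 by rewrite -size_cat -sE size_eigseq.
have := splitW _ _ jk; rewrite /flag -(eigsum_rev _ _ (eigseq q^-1 _ _)).
move/eqP: sE; rewrite (eigseq_cat _ jk) eqseq_cat ?size_eigseq //.
by case/andP=> /eqP-> /eqP->.
Qed.

Lemma dim_cap_flags q d f W j k : generic q -> (j + k = d.+1)%N ->
  (\dim (W :&: flag q d f j) + \dim (W :&: flag q^-1 d f k) <= \dim W)%N.
Proof.
move=> qg jk; rewrite -dimv_disjoint_sum.
  by apply: dimvS; rewrite subv_add !capvSl.
by apply/eqP; rewrite -subv0 -(flag_cap0 f qg jk) capvS ?capvSr.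
Qed.

Lemma flag_sub_sum q d f j : generic q -> q_diagonalizable q d f ->
  (flag q d f j <= \sum_(i < d.+1 | (i < j)%N) leigenspace f (qpow q d i))%VS.
Proof.
move=> qg df; apply: sub_eigsumP => _ /mapP[i + ->].
rewrite mem_iota capfv /= add0n => ij; have [id|di] := leqP i d; last first.
  by rewrite (leigenspace_qpow_gt qg df di) sub0v.
by apply: (sumv_sup (inord i)); rewrite inordK.
Qed.

Lemma flagV_sub_sum q d f j : generic q -> q_diagonalizable q d f ->
  (flag q^-1 d f j
     <= \sum_(i < d.+1 | (d < i + j)%N) leigenspace f (qpow q d i))%VS.
Proof.
move=> qg df; apply: sub_eigsumP => _ /mapP[i + ->].
rewrite mem_iota capfv /= add0n => ij; have [id|di] := leqP i d; last first.
  rewrite (leigenspace_qpow_gt (genericV qg) _ di) ?sub0v //.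
  exact: q_diagonalizableV.
have -> : qpow q^-1 d i = qpow q d (d - i).
  rewrite /qpow exprz_inv; congr (_ ^ _); lia.
apply: (sumv_sup (inord (d - i))); rewrite inordK //; lia.
Qed.

Lemma leigenspace_sub_flag q d f i :
  (leigenspace f (qpow q d i) <= flag q d f i.+1)%VS.
Proof. by rewrite flagS addvSl. Qed.

Lemma leigenspace_sub_flagV q d f i : (i <= d)%N ->
  (leigenspace f (qpow q d i) <= flag q^-1 d f (d - i).+1)%VS.
Proof.
move=> id; have -> : qpow q d i = qpow q^-1 d (d - i).
  rewrite /qpow exprz_inv; congr (_ ^ _); lia.
exact: leigenspace_sub_flag.
Qed.

Lemma q_decomposition q d f : generic q -> q_diagonalizable q d f ->
    (forall i, (i <= d)%N -> leigenspace f (qpow q d i) != 0%VS) ->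
  decomposition (fun i : 'I_d.+1 => leigenspace f (qpow q d i)).
Proof.
move=> qg df eig; split=> [i||]; first by rewrite eig // -ltnS.
  apply/eqP; rewrite eqEsubv subvf -[X in (X <= _)%VS]df /=.
  apply: subv_trans (flag_sub_sum _ qg df) _.
  by apply/subv_sumP => i _; apply: (sumv_sup i).
apply/directv_sumP => i _; apply/eqP; rewrite -subv0.
have out : qpow q d i \notin rem (qpow q d i) (eigseq q d d.+1).
  by rewrite mem_rem_uniq ?eigseq_uniq // !inE eqxx.
rewrite -[X in (_ <= X)%VS](eigsum_cap_leigenspace f out) capvC.
apply: capvS => //; apply/subv_sumP => j /andP[_ ji].
rewrite -[leigenspace _ _]capfv leigenspace_sub_eigsum //.
rewrite mem_rem_uniq ?eigseq_uniq // inE (inj_eq (@qpow_inj q d qg)).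
by rewrite mem_eigseq // ltn_ord andbT.
Qed.

End QFlags.

(** * Flags at the vertices of the square *)
Section RotatedFlags.
Variables (F : fieldType) (V : vectType F) (q : F) (d : nat).

(** The data of a module that the argument uses, with x1 r for x_(r,r+1) and
    x2 r for x_(r,r+2); in this form it is invariant under rotation of the
    square, so each fact is proved for one vertex r. *)
Record tet_system (x1 x2 : 'Z_4 -> 'End(V)) : Prop := TetSystem {
  x1_diag : forall r, q_diagonalizable q d (x1 r);
  x2_diag : forall r, q_diagonalizable q d (x2 r);
  x2K : forall r v, x2 r (x2 (r + 2) v) = v;
  x11 : forall r, qWeyl q (x1 r) (x1 (r + 1));
  x12 : forall r, qWeyl q (x1 r) (x2 (r + 1));
  x21 : forall r, qWeyl q (x2 r) (x1 (r + 2))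
}.

Variables x1 x2 : 'Z_4 -> 'End(V).
Hypotheses (qg : generic q) (X : tet_system x1 x2).

(** Four generators define this flag: x_(r,r+1) and x_(r,r+2) from q^d
    downwards, x_(r-1,r) and x_(r-2,r) from q^-d upwards. *)
Definition vflag (r : 'Z_4) j : {vspace V} := flag q d (x1 r) j.

Lemma flagV_x1 r j : flag q^-1 d (x1 r) j = vflag (r + 1) j.
Proof. by rewrite -(eq_flag j qg (x11 X r) (x1_diag X _) (x1_diag X _)). Qed.

Lemma flag_x2 r j : flag q d (x2 r) j = vflag r j.
Proof.
rewrite -[r](subrK 1).
rewrite (eq_flag j qg (x12 X (r - 1)) (x1_diag X _) (x2_diag X _)).
exact: flagV_x1.
Qed.

Lemma flagV_x2 r j : flag q^-1 d (x2 r) j = vflag (r + 2) j.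
Proof. by rewrite -(eq_flag j qg (x21 X r) (x2_diag X _) (x1_diag X _)). Qed.

(** The relation between x1 r and x2 (r + 1), read as a relation for q^-1 with
    the two factors exchanged. *)
Lemma x2_raises r j : (x2 (r + 1) @: vflag r j <= vflag r j.+1)%VS.
Proof.
rewrite /vflag -{1 2}[q]invrK.
exact: (limg_flag_sub d j (genericV qg) (qWeylV (x12 X r))).
Qed.

Lemma Z4_add2K (r : 'Z_4) : r + 2 + 2 = r.
Proof. by rewrite -addrA [2 + 2](_ : _ = 0) ?addr0 //; apply/val_inj. Qed.

Lemma x2_lfunV r : ((x2 r)^-1)%VF = x2 (r + 2).
Proof.
have inj : lker (x2 r) == 0%VS.
  apply/lker0P/(can_inj (g := x2 (r + 2))) => v.
  by rewrite -{2}[r]Z4_add2K (x2K X).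
apply/lfunP => v; rewrite -{1}(x2K X r v).
exact: (lker0_lfunK inj).
Qed.

Lemma lfun_x2_bij r : bijective (x2 r).
Proof.
by exists (x2 (r + 2)) => v; rewrite ?(x2K X) // -{2}[r]Z4_add2K (x2K X).
Qed.

Lemma limg_x2_low r s i : s = r + 1 ->
  (x2 s @: leigenspace (x2 r) (qpow q d i)
     <= \sum_(j < d.+1 | (j <= i.+1)%N) leigenspace (x2 r) (qpow q d j))%VS.
Proof.
move=> ->; apply: subv_trans (flag_sub_sum i.+2 qg (x2_diag X r)).
apply: subv_trans (limgS _ (leigenspace_sub_flag _ _ _ _)) _.
by rewrite !flag_x2 x2_raises.
Qed.

(** The eigenspace numbered i from q^d has number d - i from q^-d, so it lies
    in step d - i + 1 of the flag at r + 2. *)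
Lemma limg_x2_high r s i : s = r + 2 + 1 -> (i <= d)%N ->
  (x2 s @: leigenspace (x2 r) (qpow q d i)
     <= \sum_(j < d.+1 | (i <= j.+1)%N) leigenspace (x2 r) (qpow q d j))%VS.
Proof.
move=> -> id.
rewrite (eq_bigl (fun j : 'I_d.+1 => d < j + (d - i).+2)%N); last first.
  by move=> j; lia.
apply: subv_trans (flagV_sub_sum _ qg (x2_diag X r)).
apply: subv_trans (limgS _ (leigenspace_sub_flagV _ _ id)) _.
by rewrite !flagV_x2 x2_raises.
Qed.

Lemma Z4E (r : 'Z_4) : [\/ r = 0, r = 1, r = 0 + 2 | r = 1 + 2].
Proof.
case: r => [[|[|[|[|]]]] //= ?].
- by apply: Or41; apply/val_inj.
- by apply: Or42; apply/val_inj.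
- by apply: Or43; apply/val_inj.
by apply: Or44; apply/val_inj.
Qed.

(** The dimension count around the square: the inequalities for the diagonals
    (r,r+2), (r+1,r+3) and for the edge (r+2,r+3) add up to the inequality
    needed for the edge (r,r+1). *)
Lemma generators_stable W : (x2 0 @: W <= W)%VS -> (x2 1 @: W <= W)%VS ->
  forall r, (x2 r @: W <= W)%VS /\ (x1 r @: W <= W)%VS.
Proof.
move=> W0 W1.
have opp r : (x2 r @: W <= W -> x2 (r + 2) @: W <= W)%VS.
  move=> Wr.
  have inj : lker (x2 r) == 0%VS.
    exact/lker0P/bij_inj/lfun_x2_bij.
  have Weq : (x2 r @: W)%VS = W.
    apply/eqP; rewrite eqEdim Wr limg_dim_eq ?leqnn //.
    by rewrite (eqP inj) capv0.
  rewrite -{1}Weq -limg_comp -x2_lfunV lker0_compVf //.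
  by rewrite lim1g.
have Wx2 r : (x2 r @: W <= W)%VS.
  by case: (Z4E r) => ->; rewrite ?opp.
move=> r; split=> //.
apply: (flags_stable qg (x1_diag X r)) => j k jk.
have kj : (k + j = d.+1)%N by rewrite addnC.
rewrite flagV_x1.
have := dim_stable_flags qg (x2_diag X r) (Wx2 r) jk.
have := dim_stable_flags qg (x2_diag X (r + 1)) (Wx2 (r + 1)) kj.
rewrite !flag_x2 !flagV_x2.
have := dim_cap_flags (x1 (r + 2)) W qg kj.
rewrite flagV_x1 (addrAC r 2 1) /vflag; do 5!move: (\dim _) => ?; lia.
Qed.

End RotatedFlags.

(** * Modules over the q-tetrahedron algebra *)
Section TetrahedronModule.
Variables (F : fieldType) (q : F) (V : vectType F) (M : tet_module q V).

Lemma tet_adm1 r : tet_adm r (r + 1).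
Proof. by rewrite /tet_adm addrAC subrr add0r. Qed.

Lemma tet_adm2 r : tet_adm r (r + 2).
Proof. by rewrite /tet_adm addrAC subrr add0r orbT. Qed.

Definition gen1 r : 'End(V) := M (tet_x q (tet_adm1 r)).
Definition gen2 r : 'End(V) := M (tet_x q (tet_adm2 r)).

Lemma gen1E r s (rs : tet_adm r s) : s - r = 1 -> M (tet_x q rs) = gen1 r.
Proof.
move=> sr; have sE : s = r + 1 by rewrite -sr subrKC.
by rewrite sE in rs *; rewrite /gen1 (bool_irrelevance rs (tet_adm1 r)).
Qed.

Lemma gen2E r s (rs : tet_adm r s) : s - r = 2 -> M (tet_x q rs) = gen2 r.
Proof.
move=> sr; have sE : s = r + 2 by rewrite -sr subrKC.
by rewrite sE in rs *; rewrite /gen2 (bool_irrelevance rs (tet_adm2 r)).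
Qed.

Lemma act0 : M 0 = 0.
Proof.
have := tet_act_linear M (-1) 0 0.
by rewrite scaler0 addr0 scaleN1r addNr.
Qed.

Lemma actZ c a v : M (c *: a) v = c *: M a v.
Proof.
have -> : c *: a = c *: a + 0 by rewrite addr0.
by rewrite tet_act_linear act0 addr0 scale_lfunE.
Qed.

Lemma actB a b v : M (a - b) v = M a v - M b v.
Proof.
have -> : a - b = (-1) *: b + a by rewrite scaleN1r addrC.
by rewrite tet_act_linear add_lfunE scale_lfunE scaleN1r addrC.
Qed.

Lemma actD a b v : M (a + b) v = M a v + M b v.
Proof. by rewrite -[a in LHS]scale1r tet_act_linear add_lfunE scale1r. Qed.

Lemma actM a b v : M (a * b) v = M a (M b v).
Proof. by rewrite tet_actM comp_lfunE. Qed.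

Lemma act_one v : M 1 v = v.
Proof. by rewrite tet_act1 id_lfunE. Qed.

Lemma qWeyl_act (a b : tetrahedron q) : q - q^-1 != 0 ->
    (q - q^-1)^-1 *: (q *: (a * b) - q^-1 *: (b * a)) = 1 ->
  qWeyl q (M a) (M b).
Proof.
move=> qq ab1 v.
have /(congr1 ( *:%R (q - q^-1))) := congr1 (fun c => M c v) ab1.
rewrite actZ scalerA mulfV // scale1r actB.
by rewrite [X in X - _]actZ [X in _ - X]actZ !actM act_one.
Qed.

Lemma act_qWeyl r s t (rs : tet_adm r s) (st : tet_adm s t) : q - q^-1 != 0 ->
    (s - r, t - s) \in [:: (1, 1); (1, 2); (2, 1)] ->
  qWeyl q (M (tet_x q rs)) (M (tet_x q st)).
Proof. by move=> qq rst; apply: qWeyl_act (tet_x_qcomm q rs st rst). Qed.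

Lemma gen2K r v : gen2 r (gen2 (r + 2) v) = v.
Proof.
have r2 : r - (r + 2) = 2 by rewrite opprD addNKr; apply/val_inj.
have adm : tet_adm (r + 2) r by rewrite /tet_adm r2 orbT.
rewrite -(gen2E adm r2) /gen2 -actM (@tet_x_inv F q) ?act_one //.
by rewrite addrAC subrr add0r.
Qed.

Lemma tet_stable W :
  (forall r, (gen2 r @: W <= W)%VS /\ (gen1 r @: W <= W)%VS) ->
  forall a, (M a @: W <= W)%VS.
Proof.
move=> Wx a; apply/subvP => _ /memv_imgP[w + ->]; move: a w.
apply: tet_gen_ind => [w|a b IHa IHb w wW|a b IHa IHb w wW|c a IHa w wW|].
- by rewrite act_one.
- by rewrite actD memvD ?IHa ?IHb.
- by rewrite actM IHa // IHb.
- by rewrite actZ memvZ // IHa.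
move=> r s rs w wW; have [W2 W1] := Wx r; have /orP[/eqP sr|/eqP sr] := rs.
  by rewrite (gen1E rs sr) (subvP W1) // memv_img.
by rewrite (gen2E rs sr) (subvP W2) // memv_img.
Qed.

Lemma tet_x_q_diagonalizable d r s (rs : tet_adm r s) :
  has_diameter_type M d 1 -> q_diagonalizable q d (M (tet_x q rs)).
Proof.
move=> /(_ r s rs)[[t tfull] eigP]; apply/eqP.
rewrite eqEsubv subvf -tfull /=.
elim: t {tfull} => [|a t IHt]; first by rewrite big_nil sub0v.
rewrite big_cons subv_add IHt andbT.
have [->|/eigP[i id ->]] := eqVneq (leigenspace (M (tet_x q rs)) a) 0%VS.
  exact: sub0v.
rewrite mul1r -[leigenspace _ _]capfv; apply: leigenspace_sub_eigsum.
by apply/mapP; exists i; rewrite // mem_iota.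
Qed.

End TetrahedronModule.

(** * The q-inverting pair *)
Theorem theorem4p5 (F : closedFieldType) (q : F)
    (q_neq0 : q != 0)
    (q_not_root_of_1 : forall n : nat, (0 < n)%N -> q ^+ n != 1)
    (V : vectType F) (M : tet_module q V)
    (M_irr : tet_irreducible M) (M_type1 : has_type M 1) :
  q_inverting_pair q (M (x02 q)) (M (x13 q)).
Proof.
have qg : generic q by [].
have [_ [d Mdt]] := M_type1.
have K02 : M (x02 q) = gen2 M 0 by apply: gen2E; apply/val_inj.
have K13 : M (x13 q) = gen2 M 1 by apply: gen2E; apply/val_inj.
rewrite K02 K13.
have d1 r : q_diagonalizable q d (gen1 M r)
  by apply: tet_x_q_diagonalizable.
have d2 r : q_diagonalizable q d (gen2 M r)
  by apply: tet_x_q_diagonalizable.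
have qq : q - q^-1 != 0.
  apply/eqP => /subr0_eq qV; have /eqP[] := q_not_root_of_1 2%N isT.
  by rewrite expr2 {2}qV mulfV.
have diff_add (r a : 'Z_4) : r + a - r = a by rewrite addrAC subrr add0r.
have x11 r : qWeyl q (gen1 M r) (gen1 M (r + 1)).
  by apply: act_qWeyl; rewrite // !diff_add.
have x12 r : qWeyl q (gen1 M r) (gen2 M (r + 1)).
  by apply: act_qWeyl; rewrite // !diff_add.
have x21 r : qWeyl q (gen2 M r) (gen1 M (r + 2)).
  by apply: act_qWeyl; rewrite // !diff_add.
have X : tet_system q d (gen1 M) (gen2 M) by split=> //; apply: gen2K.
have dec r :
    decomposition (fun i : 'I_d.+1 => leigenspace (gen2 M r) (qpow q d i)).
  apply: q_decomposition => // i id; apply/(proj2 (Mdt _ _ (tet_adm2 r))).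
  by exists i; rewrite ?mul1r.
have kill r (i : 'I_d.+1) : ((gen2 M r - qpow q d i *: \1)
     @: leigenspace (gen2 M r) (qpow q d i))%VS = 0%VS.
  by apply/eqP; rewrite -lkerE.
split; first by split; apply: lfun_x2_bij X _.
- exists d, (fun i : 'I_d.+1 => leigenspace (gen2 M 0) (qpow q d i)).
  split; [exact: dec | move=> i; split; first exact: kill].
    by apply: (limg_x2_low qg X); apply/val_inj.
  rewrite (x2_lfunV X); apply: (limg_x2_high qg X); last by rewrite -ltnS.
  exact/val_inj.
- exists d, (fun i : 'I_d.+1 => leigenspace (gen2 M 1) (qpow q d i)).
  split; [exact: dec | move=> i; split; first exact: kill].
    by apply: (limg_x2_high qg X); [apply/val_inj | rewrite -ltnS].
  by rewrite (x2_lfunV X); apply: (limg_x2_low qg X); apply/val_inj.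
move=> W W0 W1; apply: (proj2 M_irr).
apply: tet_stable; exact: (generators_stable qg X W0 W1).
Qed.
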